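(* Let $\alpha$ be an ordinal and let $A$ be a ring. If $A$ is $\alpha$-Jacobson, then the univariate polynomial ring $A[X]$ is $(\alpha+1)$-Jacobson.
   Context: All rings are commutative with identity (the trivial ring is allowed). For a subset $U$ of a ring $A$, $\langle U\rangle$ denotes the ideal generated by $U$. $\mathrm{Nil}_A 0:=\{x\in A:\exists n\ge 0,\ x^n=0\}$ is the nilradical. The image of an element in a quotient ring is denoted by the same letter. For a ring $A$, elements $x,x'\in A$ and an ordinal $\alpha$, the property ''the triple $(A,x,x')$ is $\alpha$-Jacobson'' is defined by recursion on $\alpha$: (1) $(A,x,x')$ is $0$-Jacobson if $x'\in\mathrm{Nil}_A 0$. (2) For $\alpha>0$, $(A,x,x')$ is $\alpha$-Jacobson if there exist $n\ge 0$ and $a_1,\ldots,a_n\in A$ such that for any $b_1,\ldots,b_n\in A$ there exists an ordinal $\beta<\alpha$ such that $(A/\langle 1-b_i(1-a_ix): i\in\{1,\ldots,n\}\rangle,\,x,\,x')$ is $\beta$-Jacobson. A ring $A$ is called $\alpha$-Jacobson if $(A,x,x)$ is $\alpha$-Jacobson for all $x\in A$. *)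

(* Defs.v *)
From HB Require Import structures.
From mathcomp Require Import all_boot all_order all_algebra.
From mathcomp Require Import boolp classical_sets.

Set Implicit Arguments.
Unset Strict Implicit.
Unset Printing Implicit Defensive.

Import GRing.Theory.
Local Open Scope ring_scope.
Local Open Scope quotient_scope.

(* Rings are [comPzRingType], which, unlike [comNzRingType], includes the     *)
(* trivial ring.  The library builds ideal quotients and {poly _} only for    *)
(* nontrivial rings, so both constructions are redone here.                   *)

Definition is_ideal (A : comPzRingType) (I : set A) : Prop :=
  [/\ I 0, forall x y, I x -> I y -> I (x + y)
         & forall a x, I x -> I (a * x)].

Definition gen_ideal (A : comPzRingType) (U : set A) : set A :=
  smallest (@is_ideal A) U.

Lemma gen_ideal_is_ideal (A : comPzRingType) (U : set A) :
  is_ideal (gen_ideal U).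
Proof.
split=> [I [[I0 _ _] _]|x y Ix Iy I UI|a x Ix I UI] //.
  by have [[_ ID _] _] := UI; apply: ID; [exact: Ix | exact: Iy].
by have [[_ _ IM] _] := UI; apply: IM; exact: Ix.
Qed.

Section RingQuotient.
Variables (A : comPzRingType) (U : set A).

Definition gen_ideal_pred : {pred A} := fun x => `[< gen_ideal U x >].

Lemma gen_ideal_zmod_closed : zmod_closed gen_ideal_pred.
Proof.
have [I0 ID IM] := gen_ideal_is_ideal U.
split=> [|x y]; first exact/asboolP.
move=> /asboolP Ix /asboolP Iy; apply/asboolP.
by apply: ID => //; rewrite -mulN1r; apply: IM.
Qed.

HB.instance Definition _ :=
  GRing.isZmodClosed.Build A gen_ideal_pred gen_ideal_zmod_closed.

(* The ring A/<U>; its additive group is the library quotient of A by <U>. *)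
Definition ring_quot : Type := Quotient.quot gen_ideal_pred.

HB.instance Definition _ := GRing.Zmodule.on ring_quot.

Definition quot_proj (x : A) : ring_quot := \pi_(Quotient.quot gen_ideal_pred) x.

Lemma quot_projP x y : quot_proj x = quot_proj y <-> gen_ideal U (x - y).
Proof.
split=> [/eqP|xy].
  by rewrite /quot_proj -Quotient.idealrBE => /asboolP.
by apply/eqP; rewrite /quot_proj -Quotient.idealrBE; apply/asboolP.
Qed.

Lemma quot_proj_repr (u : ring_quot) : quot_proj (repr u) = u.
Proof. exact: reprK. Qed.

Definition quot_one : ring_quot := quot_proj 1.
Definition quot_mul (u v : ring_quot) : ring_quot :=
  quot_proj (repr u * repr v).

Lemma quot_projM x y : quot_proj (x * y) = quot_mul (quot_proj x) (quot_proj y).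
Proof.
have [_ ID IM] := gen_ideal_is_ideal U.
apply/quot_projP; set x' := repr _; set y' := repr _.
have -> : x * y - x' * y' = y * (x - x') + x' * (y - y').
  by rewrite !mulrBr [y * x]mulrC [y * x']mulrC addrA subrK.
by apply: ID; apply: IM; apply/quot_projP; rewrite quot_proj_repr.
Qed.

Lemma quot_projD x y : quot_proj (x + y) = quot_proj x + quot_proj y.
Proof. by rewrite /quot_proj !piE. Qed.

Fact quot_mulA : associative quot_mul.
Proof.
move=> u v w; rewrite -[u]quot_proj_repr -[v]quot_proj_repr -[w]quot_proj_repr.
by rewrite -!quot_projM mulrA.
Qed.

Fact quot_mulC : commutative quot_mul.
Proof. by move=> u v; rewrite /quot_mul mulrC. Qed.

Fact quot_mul1 : left_id quot_one quot_mul.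
Proof. by move=> u; rewrite -[u]quot_proj_repr -quot_projM mul1r. Qed.

Fact quot_mulDl : left_distributive quot_mul +%R.
Proof.
move=> u v w; rewrite -[u]quot_proj_repr -[v]quot_proj_repr -[w]quot_proj_repr.
by rewrite -quot_projD -!quot_projM mulrDl quot_projD.
Qed.

HB.instance Definition _ := GRing.Zmodule_isComPzRing.Build ring_quot
  quot_mulA quot_mulC quot_mul1 quot_mulDl.

Fact quot_proj_zmod_morphism : zmod_morphism quot_proj.
Proof. by move=> x y; rewrite /quot_proj !piE. Qed.

Fact quot_proj_monoid_morphism : monoid_morphism quot_proj.
Proof. by split=> // x y; exact: quot_projM. Qed.

HB.instance Definition _ :=
  GRing.isZmodMorphism.Build A ring_quot quot_proj quot_proj_zmod_morphism.
HB.instance Definition _ :=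
  GRing.isMonoidMorphism.Build A ring_quot quot_proj quot_proj_monoid_morphism.

End RingQuotient.

Section PolynomialRing.
Variable A : comPzRingType.

(* The ring A[X]: coefficient sequences with finitely many nonzero terms. *)
Record pzpoly : Type := PzPoly {
  pzcoef : nat -> A;
  pzcoef_fin : `[< exists N, forall n, (N <= n)%N -> pzcoef n = 0 >]
}.

HB.instance Definition _ := [isSub for pzcoef].
HB.instance Definition _ := [Choice of pzpoly by <:].

Lemma pzpolyP (p q : pzpoly) : (forall n, pzcoef p n = pzcoef q n) <-> p = q.
Proof. by split=> [pq|->//]; apply: val_inj; exact: funext. Qed.

Lemma pzpoly_bound (p : pzpoly) :
  exists N, forall n, (N <= n)%N -> pzcoef p n = 0.
Proof. exact/asboolP/pzcoef_fin. Qed.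

Fact pzconst_fin (a : A) :
  `[< exists N, forall n, (N <= n)%N -> (if n is 0%N then a else 0) = 0 >].
Proof. by apply/asboolP; exists 1%N; case. Qed.

Definition pzconst (a : A) : pzpoly := PzPoly (pzconst_fin a).

Fact pzopp_fin (p : pzpoly) :
  `[< exists N, forall n, (N <= n)%N -> - pzcoef p n = 0 >].
Proof.
apply/asboolP; have [N pN] := pzpoly_bound p.
by exists N => n Nn; rewrite pN ?oppr0.
Qed.

Definition pzopp (p : pzpoly) : pzpoly := PzPoly (pzopp_fin p).

Fact pzadd_fin (p q : pzpoly) :
  `[< exists N, forall n, (N <= n)%N -> pzcoef p n + pzcoef q n = 0 >].
Proof.
apply/asboolP; have [[N pN] [M qM]] := (pzpoly_bound p, pzpoly_bound q).
by exists (maxn N M) => n; rewrite geq_max => /andP[Nn Mn]; rewrite pN ?qM ?addr0.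
Qed.

Definition pzadd (p q : pzpoly) : pzpoly := PzPoly (pzadd_fin p q).

Fact pzmul_fin (p q : pzpoly) :
  `[< exists N, forall n, (N <= n)%N ->
      \sum_(i < n.+1) pzcoef p i * pzcoef q (n - i) = 0 >].
Proof.
apply/asboolP; have [[N pN] [M qM]] := (pzpoly_bound p, pzpoly_bound q).
exists (N + M)%N => n NMn; apply: big1 => i _.
have [Ni|iN] := leqP N i; first by rewrite pN ?mul0r.
have le_in : (i <= n)%N by rewrite -ltnS.
rewrite qM ?mulr0 // leq_subRL //.
by apply: leq_trans NMn; rewrite leq_add2r ltnW.
Qed.

Definition pzmul (p q : pzpoly) : pzpoly := PzPoly (pzmul_fin p q).

Fact pzaddA : associative pzadd.
Proof. by move=> p q r; apply/pzpolyP => n; rewrite /= addrA. Qed.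

Fact pzaddC : commutative pzadd.
Proof. by move=> p q; apply/pzpolyP => n; rewrite /= addrC. Qed.

Fact pzadd0 : left_id (pzconst 0) pzadd.
Proof. by move=> p; apply/pzpolyP; case=> [|n]; rewrite /= add0r. Qed.

Fact pzaddN : left_inverse (pzconst 0) pzopp pzadd.
Proof. by move=> p; apply/pzpolyP; case=> [|n]; rewrite /= addNr. Qed.

HB.instance Definition _ :=
  GRing.isZmodule.Build pzpoly pzaddA pzaddC pzadd0 pzaddN.

Fact conv_rev (f g : nat -> A) n :
  \sum_(i < n.+1) f i * g (n - i)%N = \sum_(i < n.+1) f (n - i)%N * g i.
Proof.
rewrite (reindex_inj rev_ord_inj) /=.
by apply: eq_bigr => j _; rewrite (sub_ordK j).
Qed.

Fact pzmulC : commutative pzmul.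
Proof.
move=> p q; apply/pzpolyP => n; rewrite /= conv_rev.
by apply: eq_bigr => j _; rewrite mulrC.
Qed.

Fact pzmulA : associative pzmul.
Proof.
move=> p q r; apply/pzpolyP => i /=.
rewrite (conv_rev (pzcoef (pzmul p q))) /=.
pose coef3 j k := pzcoef p j * (pzcoef q (i - j - k)%N * pzcoef r k).
transitivity (\sum_(j < i.+1) \sum_(k < i.+1 | (k <= i - j)%N) coef3 j k).
  apply: eq_bigr => j _; rewrite conv_rev big_distrr /=.
  by rewrite (big_ord_narrow_leq (leq_subr _ _)).
rewrite (exchange_big_dep predT) //=; apply: eq_bigr => k _.
transitivity (\sum_(j < i.+1 | (j <= i - k)%N) coef3 j k).
  apply: eq_bigl => j; rewrite -ltnS -(ltnS j) -!subSn ?leq_ord //.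
  by rewrite -subn_gt0 -(subn_gt0 j) -!subnDA addnC.
rewrite (big_ord_narrow_leq (leq_subr _ _)) big_distrl /=.
by apply: eq_bigr => j _; rewrite /coef3 -!subnDA addnC mulrA.
Qed.

Fact pzmul1 : left_id (pzconst 1) pzmul.
Proof.
move=> p; apply/pzpolyP => n /=; rewrite big_ord_recl subn0 mul1r big1 ?addr0 //.
by move=> i _; rewrite mul0r.
Qed.

Fact pzmulDl : left_distributive pzmul +%R.
Proof.
move=> p q r; apply/pzpolyP => n /=; rewrite -big_split.
by apply: eq_bigr => j _; rewrite mulrDl.
Qed.

HB.instance Definition _ :=
  GRing.Zmodule_isComPzRing.Build pzpoly pzmulA pzmulC pzmul1 pzmulDl.

End PolynomialRing.

(* On nontrivial rings this is the library's polynomial ring. *)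
Fact pzpoly_of_poly_fin (A : comNzRingType) (p : {poly A}) :
  `[< exists N, forall n, (N <= n)%N -> p`_n = 0 >].
Proof. by apply/asboolP; exists (size p) => n; exact: nth_default. Qed.

Definition pzpoly_of_poly (A : comNzRingType) (p : {poly A}) : pzpoly A :=
  PzPoly (pzpoly_of_poly_fin p).

Lemma pzpoly_of_poly_iso (A : comNzRingType) :
  [/\ zmod_morphism (@pzpoly_of_poly A), monoid_morphism (@pzpoly_of_poly A)
    & bijective (@pzpoly_of_poly A)].
Proof.
split; [|split|].
- by move=> p q; apply/pzpolyP => n /=; rewrite coefB.
- by apply/pzpolyP; case=> [|n]; rewrite /= coef1.
- by move=> p q; apply/pzpolyP => n /=; rewrite coefM.
pose g (p : pzpoly A) : {poly A} :=
  \poly_(i < projT1 (cid (pzpoly_bound p))) pzcoef p i.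
have gE (p : pzpoly A) n : (g p)`_n = pzcoef p n.
  rewrite coef_poly; case: cid => N pN /=.
  by case: ltnP => // /pN ->.
exists g => [p|p]; first by apply/polyP => n; rewrite gE.
by apply/pzpolyP => n; rewrite /= gE.
Qed.

(* An ordinal is represented by any well-ordered type of that order type;     *)
(* the notions below are invariant under order isomorphism.                   *)
Record wo_ordinal : Type := WoOrdinal {
  wo_sort :> Type;
  wo_lt : wo_sort -> wo_sort -> Prop;
  wo_wf : well_founded wo_lt;
  wo_trans : forall x y z, wo_lt x y -> wo_lt y z -> wo_lt x z;
  wo_total : forall x y, [\/ wo_lt x y, x = y | wo_lt y x]
}.

Definition is_ord_zero (alpha : wo_ordinal) : Prop := alpha -> False.

(* alpha is order-isomorphic to the initial segment of beta below some b. *)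
Definition ord_lt (alpha beta : wo_ordinal) : Prop :=
  exists (b : beta) (f : alpha -> beta),
    (forall x y, wo_lt x y <-> wo_lt (f x) (f y)) /\
    (forall z, wo_lt z b <-> exists x, f x = z).

Lemma ord_lt_wf : well_founded ord_lt.
Proof.
suff H (beta : wo_ordinal) (b : beta) (alpha : wo_ordinal) (f : alpha -> beta) :
    (forall x y, wo_lt x y <-> wo_lt (f x) (f y)) ->
    (forall z, wo_lt z b <-> exists x, f x = z) -> Acc ord_lt alpha.
  by move=> beta; split=> alpha [b [f [fm fi]]]; apply: H fm fi.
elim/(well_founded_ind (@wo_wf beta)): b alpha f => b IH alpha f fm fi.
split=> gamma [a [g [gm gi]]].
apply: (IH (f a) _ gamma (f \o g)); first by apply/fi; exists a.
  by move=> x y; rewrite /= -fm -gm.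
move=> z; split=> [zfa|[x <-]]; last by apply/fm/gi; exists x.
have /fi[y yz] : wo_lt z b.
  by apply: wo_trans zfa _; apply/fi; exists a.
have /gi[x xy] : wo_lt y a by apply/fm; rewrite yz.
by exists x; rewrite /= xy.
Qed.

Section Successor.
Variable alpha : wo_ordinal.

Definition succ_lt (x y : option alpha) : Prop :=
  match x, y with
  | Some a, Some b => wo_lt a b
  | Some _, None => True
  | None, _ => False
  end.

Fact succ_lt_wf : well_founded succ_lt.
Proof.
have H a : Acc succ_lt (Some a).
  by elim/(well_founded_ind (@wo_wf alpha)): a => a IH; split=> -[b /IH|].
by case=> [a|]; [exact: H | split=> -[a _|//]; exact: H].
Qed.

Fact succ_lt_trans x y z : succ_lt x y -> succ_lt y z -> succ_lt x z.
Proof. by case: x y z => [a|] [b|] [c|] //=; exact: wo_trans. Qed.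

Fact succ_lt_total x y : [\/ succ_lt x y, x = y | succ_lt y x].
Proof.
case: x y => [a|] [b|] /=; do ?by [constructor 1|constructor 2|constructor 3].
by have [ab|->|ba] := wo_total a b; [constructor 1|constructor 2|constructor 3].
Qed.

(* alpha + 1: a greatest element, None, is added to alpha. *)
Definition ord_succ : wo_ordinal :=
  WoOrdinal succ_lt_wf succ_lt_trans succ_lt_total.

End Successor.

Definition in_nilradical (A : comPzRingType) (x : A) : Prop :=
  exists n : nat, x ^+ n = 0.

(* By [ord_lt_wf] this inductive predicate is the one defined by recursion    *)
(* on alpha.                                                                  *)
Inductive jacobson_triple (alpha : wo_ordinal) (A : comPzRingType) (x x' : A) :
    Prop :=
| JacobsonZero of is_ord_zero alpha & in_nilradical x'
| JacobsonPos of ~ is_ord_zero alpha &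
    exists (n : nat) (a : 'I_n -> A), forall b : 'I_n -> A,
    let U := range (fun i : 'I_n => 1 - b i * (1 - a i * x)) in
    exists beta : wo_ordinal, ord_lt beta alpha /\
      @jacobson_triple beta (ring_quot U) (quot_proj U x) (quot_proj U x').

Definition jacobson_ring (alpha : wo_ordinal) (A : comPzRingType) : Prop :=
  forall x : A, jacobson_triple alpha x x.

(* Main.v *)
From HB Require Import structures.
Require Import Defs.
From mathcomp Require Import all_boot all_algebra.
From mathcomp Require Import perm ring boolp classical_sets.

(* For f in A[X] the single multiplier X suffices: if 1 - b (1 - X f) = 0 in  *)
(* A[X]/K, then g := 1 - b (1 - X f) lies in K, and modulo the coefficients   *)
(* of g the polynomial 1 - X f is a unit, so f is nilpotent there.  Removing  *)
(* the coefficients of g one at a time from the top, with r the leading one,  *)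
(* A[X]/K becomes integral over A once r is inverted.  Then f satisfies       *)
(* r^k f^n + ... + c_1 f + c_0 = 0 with coefficients in A, so r c_0 is a      *)
(* multiple of f, and the multipliers which A provides for r c_0 yield        *)
(* multipliers for f of the same rank: an inverse in A[X]/K of 1 - a r c_0    *)
(* is integral over A[1/r], hence already comes from A.  Descending on n      *)
(* gives the rank of (A[X]/K, f, r f), and so that of (A[X]/K, f, f).         *)

Set Implicit Arguments.
Unset Strict Implicit.
Unset Printing Implicit Defensive.

Import GRing.Theory.
Local Open Scope ring_scope.
Local Open Scope classical_set_scope.

(** [triple_jac_rank] and [jac_rank_triple] trade the quotients of the definition for ideals of one
    fixed ring. The multiplier [pzX] costs one step of rank, which leaves [jac_rank_unit] at rank
    [alpha]. No further rank is lost, because [jac_rank_combine] turns an implication between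
    nilpotency statements into one between ranks. The hypothesis on [A] enters through
    [jac_rank_integral]: where polynomials are integral over [A] with [r] inverted
    ([integral_mod_take]), an element [1 - r c] of [A] that is a unit modulo [K] has an inverse
    coming from [A] ([integral_unit]). The descent ends with [unit_coef_radical], when all
    coefficients of [g] lie in [K]. *)

(** * Radical, adjunction and saturation of ideals *)

Section Ideals.
Variables (A : comPzRingType) (I : set A).
Hypothesis idI : is_ideal I.

Lemma ideal0 : I 0. Proof. by case: idI. Qed.

Lemma idealD x y : I x -> I y -> I (x + y).
Proof. by case: idI => _ + _; apply. Qed.

Lemma idealMl a x : I x -> I (a * x).
Proof. by case: idI => _ _; apply. Qed.

Lemma idealMr a x : I x -> I (x * a).
Proof. by rewrite mulrC; exact: idealMl. Qed.

Lemma idealN x : I x -> I (- x).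
Proof. by rewrite -mulN1r; exact: idealMl. Qed.

Lemma idealB x y : I x -> I y -> I (x - y).
Proof. by move=> Ix /idealN; exact: idealD. Qed.

Lemma ideal_sum (J : finType) (F : J -> A) : (forall j, I (F j)) -> I (\sum_j F j).
Proof. by move=> IF; apply: big_ind => //; [exact: ideal0 | exact: idealD]. Qed.

Lemma ideal_cong x y : I (x - y) -> I y -> I x.
Proof. by move=> /idealD /[apply]; rewrite subrK. Qed.

Lemma ideal_congX x y n : I (x - y) -> I (x ^+ n - y ^+ n).
Proof. by move=> Ixy; rewrite subrXX; exact: idealMr. Qed.

Definition radical : set A := [set x | exists n, I (x ^+ n)].

Lemma ideal_radical x : I x -> radical x.
Proof. by exists 1%N. Qed.

Lemma radical_exp x n : radical (x ^+ n) -> radical x.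
Proof. by case=> m; rewrite -exprM; exists (n * m)%N. Qed.

Lemma radical_cong x y : I (x - y) -> radical y -> radical x.
Proof. by move=> Ixy [n Iyn]; exists n; apply: ideal_cong Iyn; exact: ideal_congX. Qed.

Lemma radicalMl a x : radical x -> radical (a * x).
Proof. by case=> n Ixn; exists n; rewrite exprMn; exact: idealMl. Qed.

Lemma radical_ideal : is_ideal radical.
Proof.
split; [exact/ideal_radical/ideal0 | | exact: radicalMl].
move=> x y [m Ixm] [n Iyn]; apply: (@radical_exp _ n).
(* [(x + y)^n - y^n] is a multiple of [x], hence in the radical, while [y^n] lies in [I]. *)
have xyE : (x + y) ^+ n - y ^+ n = x * \sum_(i < n) (x + y) ^+ (n.-1 - i) * y ^+ i.
  by rewrite subrXX addrK.
apply: (@radical_cong _ ((x + y) ^+ n - y ^+ n)).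
  by rewrite opprB addrCA subrr addr0.
by rewrite xyE mulrC; apply: radicalMl; exists m.
Qed.

Definition ideal_adjoin (u : A) : set A := [set y | exists h, I (y - u * h)].

Lemma ideal_adjoin_ideal u : is_ideal (ideal_adjoin u).
Proof.
split=> [|x y [g Ig] [h Ih]|a x [h Ih]].
- by exists 0; rewrite mulr0 subrr; exact: ideal0.
- by exists (g + h); rewrite mulrDr opprD addrACA; exact: idealD.
- by exists (a * h); rewrite mulrCA -mulrBr; exact: idealMl.
Qed.

Lemma sub_ideal_adjoin u : I `<=` ideal_adjoin u.
Proof. by move=> x Ix; exists 0; rewrite mulr0 subr0. Qed.

Lemma mem_ideal_adjoin u : ideal_adjoin u u.
Proof. by exists 1; rewrite mulr1 subrr; exact: ideal0. Qed.

(** The kernel of the map from [A] to [(A/I)[1/u]]. *)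
Definition ideal_sat (u : A) : set A := [set y | exists k, I (u ^+ k * y)].

Lemma ideal_sat_ideal u : is_ideal (ideal_sat u).
Proof.
split=> [|x y [k Ik] [l Il]|a x [k Ik]].
- by exists 0%N; rewrite mulr0; exact: ideal0.
- exists (k + l)%N; rewrite mulrDr exprD; apply: idealD.
    by rewrite mulrAC; exact: idealMr.
  by rewrite -mulrA; exact: idealMl.
- by exists k; rewrite mulrCA; exact: idealMl.
Qed.

Lemma sub_ideal_sat u : I `<=` ideal_sat u.
Proof. by move=> x Ix; exists 0%N; rewrite mul1r. Qed.

End Ideals.

Lemma radical_sub (A : comPzRingType) (I K : set A) :
  I `<=` K -> radical I `<=` radical K.
Proof. by move=> IK x [n /IK]; exists n. Qed.

Lemma ideal_adjoin_sub (A : comPzRingType) (I K : set A) u :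
  I `<=` K -> ideal_adjoin I u `<=` ideal_adjoin K u.
Proof. by move=> IK x [h /IK]; exists h. Qed.

Lemma ideal_sat_sub (A : comPzRingType) (I K : set A) u :
  I `<=` K -> ideal_sat I u `<=` ideal_sat K u.
Proof. by move=> IK x [h /IK]; exists h. Qed.

Lemma setT_ideal (A : comPzRingType) : is_ideal [set: A].
Proof. by []. Qed.

Lemma preimage_ideal (A B : comPzRingType) (phi : {rmorphism A -> B}) (K : set B) :
  is_ideal K -> is_ideal (phi @^-1` K).
Proof.
move=> [K0 KD KM]; split=> [|x y Kx Ky|a x Kx] /=.
- by rewrite rmorph0.
- by rewrite rmorphD; exact: KD.
- by rewrite rmorphM; exact: KM.
Qed.

Lemma kernel_ideal (A B : comPzRingType) (phi : {rmorphism A -> B}) :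
  is_ideal [set y | phi y = 0].
Proof.
apply: (preimage_ideal phi (K := [set 0])); split=> //= [x y -> ->|a x ->].
  by rewrite addr0.
by rewrite mulr0.
Qed.

(** * Jacobson rank of ideals in a fixed ring *)

Section Rank.
Variable W : wo_ordinal.

Definition units_mod (A : comPzRingType) (K : set A) (s : seq A) (x : A) :=
  forall a, a \in s -> exists b, K (1 - b * (1 - a * x)).

(* [(A/I, x, x')] is Jacobson of rank the order type of [{v | v < w}]; the   *)
(* quotients in the definition are replaced by ideals of the fixed ring A.   *)
Inductive jac_rank (A : comPzRingType) (w : W) (I : set A) (x x' : A) : Prop :=
| JacNil of radical I x'
| JacStep (s : seq A) of (forall K, is_ideal K -> I `<=` K -> units_mod K s x ->
    exists2 v, wo_lt v w & jac_rank v K x x').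

(** A step is impossible at the least rank: the unit ideal satisfies [units_mod] for every [s] and
    would receive a smaller rank. *)
Lemma jac_rank0 (A : comPzRingType) w (I : set A) x x' :
  ~ (exists v, wo_lt v w) -> jac_rank w I x x' -> radical I x'.
Proof.
move=> w0 [//|s /(_ setT)] /(_ (@setT_ideal A)) [] //.
  by move=> a _; exists 0.
by move=> v vw; case: w0; exists v.
Qed.

(** At a positive rank [JacNil] is a step with the empty list, as nilpotency passes to larger
    ideals. *)
Lemma jac_rank_pos (A : comPzRingType) w (I : set A) x x' :
  (exists v, wo_lt v w) -> jac_rank w I x x' ->
  exists s : seq A, forall K, is_ideal K -> I `<=` K -> units_mod K s x ->
    exists2 v, wo_lt v w & jac_rank v K x x'.
Proof.
move=> [v vw] [Ix|s Hs]; last by exists s.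
exists [::] => K _ IK _; exists v => //; apply: JacNil; exact: radical_sub Ix.
Qed.

Lemma jac_rank_lt (A : comPzRingType) v w (I : set A) x x' :
  wo_lt v w -> jac_rank v I x x' -> jac_rank w I x x'.
Proof.
move=> vw [Ix|s Hs]; first exact: JacNil.
apply: (JacStep (s := s)) => K idK IK Ks; have [u uv Hu] := Hs K idK IK Ks.
by exists u => //; exact: wo_trans uv vw.
Qed.

(** Both lists of multipliers are imposed at once: as [T1] and [T2] enlarge ideals, an inverse
    modulo [L] is also one modulo [T1 L] and [T2 L]. Of the two smaller ranks obtained, the larger
    serves both. At the least rank only nilpotency is left. *)
Lemma jac_rank_combine (A : comPzRingType) (T1 T2 : set A -> set A) (x x1 x2 x3 : A) :
  (forall K, is_ideal K -> is_ideal (T1 K)) ->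
  (forall K, is_ideal K -> is_ideal (T2 K)) ->
  (forall K, K `<=` T1 K) -> (forall K, K `<=` T2 K) ->
  (forall K L, K `<=` L -> T1 K `<=` T1 L) ->
  (forall K L, K `<=` L -> T2 K `<=` T2 L) ->
  (forall K, is_ideal K -> radical (T1 K) x1 -> radical (T2 K) x2 -> radical K x3) ->
  forall w K, is_ideal K ->
  jac_rank w (T1 K) x x1 -> jac_rank w (T2 K) x x2 -> jac_rank w K x x3.
Proof.
move=> id1 id2 sub1 sub2 mono1 mono2 rad123 w.
elim/(well_founded_ind (@wo_wf W)): w => w IH K idK G1 G2.
have [wpos|w0] := pselect (exists v, wo_lt v w); last first.
  by apply: JacNil; apply: rad123 => //; [exact: jac_rank0 G1 | exact: jac_rank0 G2].
have [s1 H1] := jac_rank_pos wpos G1; have [s2 H2] := jac_rank_pos wpos G2.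
apply: (JacStep (s := s1 ++ s2)) => L idL KL Ls.
have [||v1 v1w J1] := H1 (T1 L) (id1 _ idL); first exact: mono1.
  by move=> a a1; have [|b Lb] := Ls a; [rewrite mem_cat a1 | exists b; exact: sub1].
have [||v2 v2w J2] := H2 (T2 L) (id2 _ idL); first exact: mono2.
  by move=> a a2; have [|b Lb] := Ls a; [rewrite mem_cat a2 orbT | exists b; exact: sub2].
have [v12|v12|v21] := wo_total v1 v2.
- by exists v2 => //; apply: IH => //; exact: jac_rank_lt J1.
- by exists v2 => //; apply: IH => //; rewrite -v12.
- by exists v1 => //; apply: IH => //; exact: jac_rank_lt J2.
Qed.

Lemma jac_rank_sub (A : comPzRingType) w (I K : set A) x x' :
  I `<=` K -> jac_rank w I x x' -> jac_rank w K x x'.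
Proof.
move=> IK [Ix|s Hs]; first exact/JacNil/(radical_sub IK).
apply: (JacStep (s := s)) => L idL KL; apply: Hs => //.
exact: subset_trans KL.
Qed.

End Rank.

(** * Integral dependence after inverting an element *)

Section Integral.
Variables (A B : comPzRingType) (phi : {rmorphism A -> B}).

(* [y] becomes integral over [A[1/r]] in [(B/K)[1/r]]. *)
Definition integral_mod (r : A) (K : set B) (y : B) := exists n k (c : nat -> A),
  K (\sum_(j < n) phi (c j) * y ^+ j + phi (r ^+ k) * y ^+ n).

Lemma one_expansion (e : A) k : exists d, 1 = e * d + (1 - e) ^+ k.
Proof.
exists (\sum_(i < k) (1 - e) ^+ i).
have := subrX1 (1 - e) k; rewrite addrAC subrr add0r mulNr => /eqP.
by rewrite subr_eq => /eqP ->; rewrite addrA subrr add0r.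
Qed.

(* An inverse of [e] modulo [K] is integral over [A[1/r]]; clearing it of its *)
(* powers shows that [e] divides a power of [r] modulo the preimage of [K],   *)
(* and [e] is comaximal with [r].                                             *)
Lemma integral_unit (r c : A) (K : set B) (b : B) (e := 1 - r * c) : is_ideal K ->
  integral_mod r K b -> K (1 - b * phi e) -> exists d, K (phi (1 - d * e)).
Proof.
move=> idK [n [k [a Ka]]] Kbe.
have Kbe1 j : K (1 - (b * phi e) ^+ j).
  by rewrite -[X in X - _](expr1n _ j); exact: ideal_congX.
(* The equation of [b] times [phi e ^+ n]: modulo [K] each [b ^+ j] absorbs [j] of the factors
   [phi e]. *)
have Krk : K (phi (\sum_(j < n) a j * e ^+ (n - j) + r ^+ k)).
  have := idealMr idK (phi e ^+ n) Ka; apply: ideal_cong => //.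
  rewrite rmorphD rmorph_sum /= mulrDl mulr_suml opprD addrACA -sumrB.
  apply: idealD => //; last first.
    by rewrite -mulrA -exprMn -[X in X - _]mulr1 -mulrBr; exact: idealMl.
  apply: ideal_sum => // j.
  have -> : phi (a j * e ^+ (n - j)) - phi (a j) * b ^+ j * phi e ^+ n =
     phi (a j * e ^+ (n - j)) * (1 - (b * phi e) ^+ j).
    rewrite mulrBr mulr1 rmorphM rmorphXn /= exprMn.
    have -> : phi e ^+ n = phi e ^+ (n - j) * phi e ^+ j.
      by rewrite -exprD subnK // ltnW.
    by congr (_ - _); ring.
  exact: idealMl.
have [d0 d0E] : exists d0, \sum_(j < n) a j * e ^+ (n - j) = e * d0.
  exists (\sum_(j < n) a j * e ^+ (n - j).-1); rewrite mulr_sumr.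
  apply: eq_bigr => j _.
  by rewrite mulrCA -exprS prednK // subn_gt0.
have [d1 d1E] := one_expansion e k.
exists (d1 - c ^+ k * d0).
have -> : 1 - (d1 - c ^+ k * d0) * e = c ^+ k * (e * d0 + r ^+ k).
  rewrite [X in X - _]d1E {2}/e subKr exprMn; ring.
by rewrite rmorphM -d0E; exact: idealMl.
Qed.

Lemma integral_mod_sub r (K L : set B) y :
  K `<=` L -> integral_mod r K y -> integral_mod r L y.
Proof. by move=> KL [n [k [c /KL]]]; exists n, k, c. Qed.

Variable W : wo_ordinal.

(** A multiplier [a] for [r * c] becomes [phi a * h] for [f], since [f * h] is [phi (r * c)] modulo
    [K]. By [integral_unit] the resulting inverses come from [A], so the preimage of [L] is
    admissible for [r * c] and the rank is unchanged. *)
Lemma jac_rank_integral (r c x' : A) (f h : B) (w : W) (K : set B) :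
  is_ideal K -> (forall y, integral_mod r K y) -> K (phi (r * c) - f * h) ->
  jac_rank w (phi @^-1` K) (r * c) x' -> jac_rank w K f (phi x').
Proof.
elim/(well_founded_ind (@wo_wf W)): w K => w IH K idK intK Krc [[n Kn]|s Hs].
  by apply: JacNil; exists n; rewrite -rmorphXn.
apply: (JacStep (s := [seq phi a * h | a <- s])) => L idL KL Ls.
have intL y : integral_mod r L y by exact: integral_mod_sub (intK y).
have [|x Kx|a sa|v vw Gv] := Hs (phi @^-1` L).
- exact: preimage_ideal.
- exact: KL.
- have [b Lb] := Ls _ (map_f (fun a => phi a * h) sa).
  have [] := @integral_unit r (a * c) L b idL (intL b).
    apply: ideal_cong Lb => //.
    have -> : 1 - b * phi (1 - r * (a * c)) - (1 - b * (1 - phi a * h * f)) =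
              b * phi a * (phi (r * c) - f * h).
      by rewrite !(rmorphB, rmorphM, rmorph1) /=; ring.
    by apply: idealMl => //; exact: KL.
  by move=> d Ld; exists d; rewrite mulrCA.
- by exists v => //; apply: IH => //; exact: KL.
Qed.

(* Descent on the degree of an equation of [f] with constant coefficient      *)
(* [c 0]: modulo [r * c 0], and up to [r f]-torsion, it can be divided by [f]. *)
Lemma jac_rank_integral_self (r : A) (f : B) (w : W) (K : set B) :
  (forall a : A, jac_rank w [set 0] a a) ->
  is_ideal K -> (forall y, integral_mod r K y) -> jac_rank w K f (phi r * f).
Proof.
move=> HA idK intK; have [n [k [c Kc]]] := intK f.
elim: n c K idK intK Kc => [|n IHn] c K idK intK Kc.
  (* In degree 0 the equation says that [phi (r ^+ k)] is in [K]. *)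
  apply: JacNil; exists k; rewrite exprMn; apply: idealMr => //.
  by move: Kc; rewrite big_ord0 add0r mulr1 rmorphXn.
set q := \sum_(j < n) phi (c j.+1) * f ^+ j + phi (r ^+ k) * f ^+ n.
have cq : K (phi (c 0%N) + f * q).
  move: Kc; rewrite big_ord_recl mulr1 -addrA.
  congr (K (_ + _)); rewrite /q mulrDr mulr_sumr exprS [in RHS]mulrCA.
  by congr (_ + _); apply: eq_bigr => j _; rewrite lift0 exprS mulrCA.
pose u := phi r * f; pose v := phi (r * c 0%N).
pose T1 (L : set B) := L; pose T2 L := ideal_sat (ideal_adjoin L v) u.
have idT2 L : is_ideal L -> is_ideal (T2 L).
  by move=> idL; apply/ideal_sat_ideal/ideal_adjoin_ideal.
have subT2 L : L `<=` T2 L.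
  by apply: subset_trans (@sub_ideal_sat _ _ _) => y Ly; exact: sub_ideal_adjoin.
apply: (@jac_rank_combine _ _ T1 T2 f v u) => //.
- by move=> L M; exact.
- by move=> L M LM; apply: ideal_sat_sub; exact: ideal_adjoin_sub.
(* A power of [u] is a multiple of [v] modulo [L], and [v] is nilpotent there. *)
- move=> L idL [m Lm] [l [i [h Lh]]].
  apply: (@radical_exp _ _ _ (i + l)); apply: (@radical_cong _ _ idL _ (v * h)).
    by rewrite exprD.
  by exists m; rewrite exprMn; exact: idealMr.
- apply: (@jac_rank_integral r (c 0%N) _ f (- (phi r * q))) => //.
    have -> : phi (r * c 0%N) - f * - (phi r * q) = phi r * (phi (c 0%N) + f * q).
      by rewrite rmorphM /=; ring.
    exact: idealMl.
  apply: jac_rank_sub (HA (r * c 0%N)) => _ -> /=.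
  by rewrite rmorph0; exact: ideal0.
- apply: (IHn (fun j => c j.+1)) => //; first exact: idT2.
    by move=> y; apply: integral_mod_sub (intK y).
  (* [u * q + v] is in [K], so [T2 K] contains [q], which is the equation of lower degree. *)
  rewrite -/q; exists 1%N; exists (- 1).
  have -> : u ^+ 1 * q - v * - 1 = phi r * (phi (c 0%N) + f * q).
    by rewrite /u /v expr1 rmorphM /=; ring.
  exact: idealMl.
Qed.

End Integral.

(** * Determinants of matrices linear in [y] *)

Section LinearDeterminant.
Variables (A B : comPzRingType) (phi : {rmorphism A -> B}) (y : B).

(** A relation, because an element of [B] can have several expressions in [y]; [d] is a formal
    leading coefficient and may be zero. *)
Definition degree_lead (n : nat) (z : B) (d : A) :=
  exists c : nat -> A, z = \sum_(j < n) phi (c j) * y ^+ j + phi d * y ^+ n.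

Lemma degree_lead0 n : degree_lead n 0 0.
Proof.
exists (fun=> 0); rewrite rmorph0 mul0r addr0 big1 // => j _.
by rewrite mul0r.
Qed.

Lemma degree_leadD n z z' d d' :
  degree_lead n z d -> degree_lead n z' d' -> degree_lead n (z + z') (d + d').
Proof.
move=> [c ->] [c' ->]; exists (fun j => c j + c' j).
rewrite rmorphD mulrDl addrACA -big_split /=.
by congr (_ + _); apply: eq_bigr => j _; rewrite rmorphD mulrDl.
Qed.

Lemma degree_leadZ n a z d : degree_lead n z d -> degree_lead n (phi a * z) (a * d).
Proof.
move=> [c ->]; exists (fun j => a * c j).
rewrite mulrDr mulr_sumr rmorphM mulrA.
by congr (_ + _); apply: eq_bigr => j _; rewrite rmorphM mulrA.
Qed.

Lemma degree_lead_shift n z d : degree_lead n z d -> degree_lead n.+1 (y * z) d.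
Proof.
move=> [c ->]; exists (fun j => if j is i.+1 then c i else 0).
rewrite big_ord_recl rmorph0 mul0r add0r mulrDr mulr_sumr exprS mulrCA.
by congr (_ + _); apply: eq_bigr => j _; rewrite lift0 exprS mulrCA.
Qed.

Lemma degree_lead_raise n z d : degree_lead n z d -> degree_lead n.+1 z 0.
Proof.
move=> [c ->]; exists (fun j => if (j < n)%N then c j else d).
rewrite rmorph0 mul0r addr0 big_ord_recr /= ltnn.
by congr (_ + _); apply: eq_bigr => j _; rewrite ltn_ord.
Qed.

Lemma degree_lead_prod n (s m : 'I_n -> A) :
  degree_lead n (\prod_i (phi (s i) * y + phi (m i))) (\prod_i s i).
Proof.
elim: n s m => [|n IHn] s m.
  by rewrite !big_ord0; exists (fun=> 0); rewrite big_ord0 rmorph1 add0r mulr1.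
rewrite !big_ord_recl; set z := \prod_i _; set d := \prod_i _.
have zd : degree_lead n z d by exact: IHn.
rewrite mulrDl -mulrA.
have -> : s ord0 * d = s ord0 * d + m ord0 * 0 by rewrite mulr0 addr0.
apply: degree_leadD; apply: degree_leadZ; first exact: degree_lead_shift.
exact: degree_lead_raise zd.
Qed.

(** Each term of the Leibniz formula is a product of [n] linear factors, whose leading coefficient
    is the matching term of [\det S]. *)
Lemma degree_lead_det n (S M : 'M[A]_n) :
  degree_lead n (\det (\matrix_(i, j) (phi (S i j) * y + phi (M i j)))) (\det S).
Proof.
rewrite /determinant; apply: (big_ind2 (degree_lead n)) => [||s _].
- exact: degree_lead0.
- by move=> *; exact: degree_leadD.
- rewrite -(rmorph_sign phi); apply: degree_leadZ.
  rewrite (eq_bigr (fun i => phi (S i (s i)) * y + phi (M i (s i)))).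
    exact: (degree_lead_prod (fun i => S i (s i)) (fun i => M i (s i))).
  by move=> i _; rewrite mxE.
Qed.

(* The determinant trick: [\det N] kills the vector [v], and [v ord0 = 1]. *)
Lemma det_integral (r : A) (K : set B) n (v : 'I_n.+1 -> B) (k : 'I_n.+1 -> nat)
    (C : 'M[A]_n.+1) : is_ideal K -> v ord0 = 1 ->
  (forall j, K (phi (r ^+ k j) * y * v j - \sum_l phi (C j l) * v l)) ->
  integral_mod phi r K y.
Proof.
move=> idK v0 Kv.
pose S : 'M[A]_n.+1 := diag_mx (\row_j r ^+ k j).
pose N := \matrix_(i, j) (phi (S i j) * y + phi ((- C) i j)).
have KNv j : K (\sum_l N j l * v l).
  have -> : \sum_l N j l * v l = \sum_l (phi (S j l) * y * v l - phi (C j l) * v l).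
    by apply: eq_bigr => l _; rewrite !mxE mulrDl rmorphN mulNr.
  have := Kv j; rewrite sumrB; congr (K (_ - _)); rewrite (bigD1 j) //= big1.
    by rewrite addr0 !mxE eqxx mulr1n.
  by move=> l lj; rewrite !mxE eq_sym (negPf lj) mulr0n rmorph0 !mul0r.
have KdetN : K (\det N).
  have -> : \det N = \sum_j (\adj N) ord0 j * \sum_l N j l * v l.
    have -> : \det N = \sum_l (\adj N *m N) ord0 l * v l.
      rewrite mul_adj_mx (bigD1 ord0) //= big1 => [|l l0].
        by rewrite v0 mulr1 addr0 mxE eqxx mulr1n.
      by rewrite mxE eq_sym (negPf l0) mulr0n mul0r.
    under [RHS]eq_bigr do rewrite mulr_sumr.
    rewrite exchange_big /=; apply: eq_bigr => l _.
    by rewrite mxE mulr_suml; apply: eq_bigr => j _; rewrite mulrA.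
  by apply: ideal_sum => // j; exact: idealMl.
have [c detE] := degree_lead_det S (- C).
exists n.+1, (\sum_j k j)%N, c.
have -> : r ^+ (\sum_j k j)%N = \det S.
  by rewrite det_diag expr_sum; apply: eq_bigr => j _; rewrite mxE.
by rewrite -detE.
Qed.

End LinearDeterminant.

(** * Polynomials modulo an ideal and their coefficients *)

Section Polynomials.
Variable A : comPzRingType.
Implicit Types (p q f g b : pzpoly A) (a r : A).

Fact pzconst_zmod_morphism : zmod_morphism (@pzconst A).
Proof. by move=> x y; apply/pzpolyP; case=> [|n] //=; rewrite subr0. Qed.

Fact pzconst_monoid_morphism : monoid_morphism (@pzconst A).
Proof.
split=> // x y; apply/pzpolyP => n /=; rewrite big_ord_recl subn0 big1 ?addr0.
  by case: n => [|n] //; rewrite mulr0.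
by move=> i _; rewrite mul0r.
Qed.

HB.instance Definition _ :=
  GRing.isZmodMorphism.Build A (pzpoly A) (@pzconst A) pzconst_zmod_morphism.
HB.instance Definition _ :=
  GRing.isMonoidMorphism.Build A (pzpoly A) (@pzconst A) pzconst_monoid_morphism.

Lemma pzcoefC_mul a p n : pzcoef (pzconst a * p) n = a * pzcoef p n.
Proof.
rewrite [LHS]big_ord_recl subn0 big1 ?addr0 // => i _; exact: mul0r.
Qed.

Fact pzX_fin : `[< exists N, forall n, (N <= n)%N -> (n == 1%N)%:R = 0 :> A >].
Proof. by apply/asboolP; exists 2%N; case=> [|[]]. Qed.

Definition pzX : pzpoly A := PzPoly pzX_fin.

Lemma pzcoefX_mul p n :
  pzcoef (pzX * p) n = if n is m.+1 then pzcoef p m else 0.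
Proof.
rewrite /= big_ord_recl mul0r add0r; case: n => [|n]; first by rewrite big_ord0.
rewrite big_ord_recl mul1r big1 ?addr0 ?subn1 // => i _.
by rewrite !lift0 mul0r.
Qed.

Fact pzbehead_fin p :
  `[< exists N, forall n, (N <= n)%N -> pzcoef p n.+1 = 0 >].
Proof.
apply/asboolP; have [N pN] := pzpoly_bound p; exists N => n Nn.
by rewrite pN // ltnW.
Qed.

Definition pzbehead p : pzpoly A := PzPoly (pzbehead_fin p).

Lemma pzpoly_horner p : p = pzconst (pzcoef p 0) + pzX * pzbehead p.
Proof.
apply/pzpolyP => n.
rewrite -[RHS]/(pzcoef (pzconst _) n + pzcoef (pzX * pzbehead p) n) pzcoefX_mul.
by case: n => [|n]; rewrite ?addr0 ?add0r.
Qed.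

Lemma pzpoly_ind (P : pzpoly A -> Prop) :
  P 0 -> (forall a p, P p -> P (pzconst a + pzX * p)) -> forall p, P p.
Proof.
move=> P0 PX p; have [N] := pzpoly_bound p; elim: N p => [|N IHN] p pN.
  by have -> : p = 0 by apply/pzpolyP => n; rewrite pN //; case: n.
by rewrite [p]pzpoly_horner; apply: PX; apply: IHN => n /= Nn; rewrite pN.
Qed.

Lemma pzpoly_sum p N : (forall n, (N <= n)%N -> pzcoef p n = 0) ->
  p = \sum_(i < N) pzconst (pzcoef p i) * pzX ^+ i.
Proof.
elim: N p => [|N IHN] p pN.
  by rewrite big_ord0; apply/pzpolyP => n; rewrite pN //; case: n.
rewrite big_ord_recl mulr1 {1}[p]pzpoly_horner; congr (_ + _).
rewrite {1}[pzbehead p]IHN => [|n Nn]; last by rewrite /= pN.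
by rewrite mulr_sumr; apply: eq_bigr => i _; rewrite lift0 exprS mulrCA.
Qed.

Lemma ideal_coef (K : set (pzpoly A)) p : is_ideal K ->
  (forall n, K (pzconst (pzcoef p n))) -> K p.
Proof.
move=> idK; have [N] := pzpoly_bound p => pN Kp; rewrite (pzpoly_sum pN).
by apply: ideal_sum => // i; exact: idealMr.
Qed.

Fact pztake_fin m p :
  `[< exists N, forall n, (N <= n)%N -> (if (n < m)%N then pzcoef p n else 0) = 0 >].
Proof. by apply/asboolP; exists m => n; rewrite ltnNge => ->. Qed.

Definition pztake m p : pzpoly A := PzPoly (pztake_fin m p).

Lemma ideal_take (K : set (pzpoly A)) m p : is_ideal K -> K p ->
  (forall n, (m <= n)%N -> K (pzconst (pzcoef p n))) -> K (pztake m p).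
Proof.
move=> idK Kp Kn; rewrite -[pztake m p](subKr p); apply: idealB => //.
apply: ideal_coef => // n /=; case: ltnP => [_|/Kn]; last by rewrite subr0.
by rewrite subrr rmorph0; exact: ideal0.
Qed.

(** Pseudo-division by the truncation brings every polynomial, up to a power of [r], to degree below
    [i]. The determinant trick then applies to multiplication by [y] on the powers of [pzX] below
    [i]. *)
Lemma integral_mod_take (K : set (pzpoly A)) i p : is_ideal K -> K (pztake i.+1 p) ->
  forall y, integral_mod (@pzconst A) (pzcoef p i) K y.
Proof.
set t := pztake _ _; set r := pzcoef p i => idK Kt y.
have ti : pzcoef t i = r by rewrite /= ltnSn.
have t_gt n : (i < n)%N -> pzcoef t n = 0 by move=> lt_in; rewrite /= ltnNge lt_in.
case: i @t @r Kt ti t_gt => [|i] t r Kt ti t_gt.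
  (* For constant [t], the image of [r] is in [K]: an equation of degree 0. *)
  exists 0%N, 1%N, (fun=> 0); rewrite big_ord0 add0r mulr1 expr1.
  by have := Kt; rewrite [t](pzpoly_sum t_gt) big_ord1 mulr1 ti.
have red z : exists k q, (forall n, (i < n)%N -> pzcoef q n = 0) /\
    K (pzconst (r ^+ k) * z - q).
  elim/pzpoly_ind: z => [|a z [k [q [q0 Kq]]]].
    exists 0%N, 0; split; first by case.
    by rewrite mulr0 subr0; exact: ideal0.
  (* The multiple of [t] cancels the coefficient of [r X q] in degree [i.+1]. *)
  exists k.+1, (pzconst (r ^+ k.+1 * a) + pzconst r * (pzX * q)
                - pzconst (pzcoef q i) * t); split.
    case=> // n; rewrite ltnS => i_n /=.
    rewrite -[X in _ + X - _]/(pzcoef (pzconst r * (pzX * q)) n.+1).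
    rewrite -[X in _ - X]/(pzcoef (pzconst (pzcoef q i) * t) n.+1).
    rewrite !pzcoefC_mul pzcoefX_mul add0r.
    move: i_n; rewrite leq_eqVlt => /predU1P[<-|i_n].
      by rewrite ti mulrC subrr.
    by rewrite q0 // t_gt // !mulr0 subrr.
  have -> : pzconst (r ^+ k.+1) * (pzconst a + pzX * z) -
      (pzconst (r ^+ k.+1 * a) + pzconst r * (pzX * q) - pzconst (pzcoef q i) * t) =
      pzconst r * pzX * (pzconst (r ^+ k) * z - q) + pzconst (pzcoef q i) * t.
    by rewrite exprS !rmorphM /=; ring.
  by apply: idealD => //; apply: idealMl.
have /choice[kq kqE] : forall j : 'I_i.+1, exists kq : nat * pzpoly A,
    (forall n, (i < n)%N -> pzcoef kq.2 n = 0) /\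
    K (pzconst (r ^+ kq.1) * (y * pzX ^+ j) - kq.2).
  by move=> j; have [k [q ?]] := red (y * pzX ^+ j); exists (k, q).
apply: (@det_integral _ _ _ y r K i (fun j => pzX ^+ j) (fun j => (kq j).1)
  (\matrix_(j, l) pzcoef (kq j).2 l)) => // j.
have [q0 Kq] := kqE j; rewrite -mulrA; congr (K (_ - _)): Kq.
rewrite {1}[(kq j).2](pzpoly_sum q0).
by apply: eq_bigr => l _; rewrite mxE.
Qed.

(* Saturating [c] by the leading coefficient [d] of [f] captures the          *)
(* coefficients of [b] from the top down, hence 1, so that [d] is in [c].     *)
Lemma unit_coef_radical (c : set A) f b : is_ideal c -> radical c `<=` c ->
  (forall n, c (pzcoef (1 - b * (1 - pzX * f)) n)) -> forall n, c (pzcoef f n).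
Proof.
move=> idc radc cbu.
have u0 : pzcoef (1 - pzX * f) 0 = 1.
  by rewrite -[LHS]/(_ - pzcoef (pzX * f) 0) pzcoefX_mul subr0.
have uS n : pzcoef (1 - pzX * f) n.+1 = - pzcoef f n.
  by rewrite -[LHS]/(_ - pzcoef (pzX * f) n.+1) pzcoefX_mul sub0r.
move: (1 - pzX * f) cbu u0 uS => u cbu u0 uS.
have [N fN] := pzpoly_bound f.
have {fN} : forall n, (N <= n)%N -> c (pzcoef f n).
  by move=> n /fN ->; exact: ideal0.
elim: N => [|N IHN] cf; first by move=> n; exact: cf.
apply: IHN => n; rewrite leq_eqVlt => /predU1P[<-|]; last exact: cf.
pose c' := ideal_sat c (pzcoef f N).
have idc' : is_ideal c' by exact: ideal_sat_ideal.
have cc' x : c x -> c' x by exact: sub_ideal_sat.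
have [M bM] := pzpoly_bound b.
have : c' (pzcoef b 0%N).
  have {bM} : forall n, (M <= n)%N -> c' (pzcoef b n).
    by move=> m /bM ->; exact: ideal0.
  elim: M => [|M IHM] c'b; first exact: c'b.
  apply: IHM => m; rewrite leq_eqVlt => /predU1P[<-|]; last exact: c'b.
  have ltM : (M < (M + N).+2)%N by rewrite !ltnS leqW // leq_addr.
  (* In degree [M + N + 1] of [b * u], terms with [i < M] carry a coefficient of [f] beyond [N], and
     those with [i > M] a coefficient of [b] already in [c']. *)
  have c'bu : c' (\sum_(i < (M + N).+2) pzcoef b i * pzcoef u ((M + N).+1 - i)).
    rewrite -[X in c' X]opprK; apply: idealN => //.
    by have := cc' _ (cbu (M + N).+1); rewrite /= sub0r.
  have : c' (pzcoef b M * pzcoef f N).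
    rewrite -[X in c' X]opprK -mulrN -uS; apply: idealN => //.
    apply: ideal_cong c'bu => //; rewrite (bigD1 (Ordinal ltM)) //= opprD.
    rewrite subSn ?leq_addr // addKn addrA subrr add0r.
    apply: idealN => //; apply: (big_ind c'); first exact: ideal0.
      by move=> *; exact: idealD.
    move=> i; rewrite -val_eqE /= neq_ltn => /orP[iM|Mi].
      apply: idealMl => //; rewrite subSn; last by rewrite (leq_trans (ltnW iM)) ?leq_addr.
      rewrite uS; apply: idealN => //; apply/cc'/cf.
      by rewrite -addnBAC ?(ltnW iM) // -[N.+1]add1n leq_add2r subn_gt0.
    by apply: idealMr => //; exact: c'b.
  case=> k ck; exists k.+1; rewrite exprSr.
  by rewrite -mulrA [_ * pzcoef b M]mulrC.
move=> c'b0; have : c' 1.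
  apply: ideal_cong c'b0 => //; have := cc' _ (cbu 0%N).
  by rewrite /= big_ord_recl big_ord0 u0 mulr1 addr0.
by case=> k; rewrite mulr1 => ck; apply: radc; exists k.
Qed.

(* Induction on the number of coefficients of [g] not yet known to lie in K;  *)
(* f is split into r f in A[X]/K and f in A[X]/(K, r).                        *)
Lemma jac_rank_unit (W : wo_ordinal) (w : W) f b (K : set (pzpoly A)) :
  (forall a : A, jac_rank w [set 0] a a) -> is_ideal K ->
  K (1 - b * (1 - pzX * f)) -> jac_rank w K f f.
Proof.
set g := 1 - _ => HA idK Kg.
have [N gN] := pzpoly_bound g.
have {gN} : forall n, (N <= n)%N -> K (pzconst (pzcoef g n)).
  by move=> n /gN ->; rewrite rmorph0; exact: ideal0.
elim: N K idK Kg => [|N IHN] K idK Kg Kn.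
  apply: JacNil; apply: ideal_coef; first exact: radical_ideal.
  apply: (@unit_coef_radical (@pzconst A @^-1` radical K) f b).
  - exact/preimage_ideal/radical_ideal.
  - by move=> x [n]; rewrite /= rmorphXn => /radical_exp.
  - by move=> n /=; apply: ideal_radical; exact: Kn.
set r := pzcoef g N.
apply: (@jac_rank_combine _ _ id (fun L => ideal_adjoin L (pzconst r)) f
  (pzconst r * f) f f) => //.
- by move=> L idL; exact: ideal_adjoin_ideal.
- by move=> L; exact.
- by move=> L; exact: sub_ideal_adjoin.
- by move=> L M; exact: ideal_adjoin_sub.
(* If [f^m] is [r h] modulo [L], then [f^(m+1)] is [h (r f)], which is nilpotent. *)
- move=> L idL Lrf [m [h Lh]]; apply: (@radical_exp _ _ _ m.+1).
  apply: (@radical_cong _ _ idL _ (h * (pzconst r * f))).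
    rewrite exprS; have := idealMl idL f Lh; congr (L _); ring.
  exact: radicalMl.
- apply: jac_rank_integral_self => //; apply: integral_mod_take => //.
  exact: ideal_take.
- apply: IHN; first exact: ideal_adjoin_ideal.
    exact: sub_ideal_adjoin.
  move=> n; rewrite leq_eqVlt => /predU1P[<-|Nn]; first exact: mem_ideal_adjoin.
  by apply: sub_ideal_adjoin; exact: Kn.
Qed.

End Polynomials.

(** * Comparison of ranks with ordinals *)

Section Segments.
Variables (W : wo_ordinal) (w : W).

Let seg_lt (u v : {v : W | wo_lt v w}) := wo_lt (sval u) (sval v).

Fact seg_wf : well_founded seg_lt.
Proof.
case=> v; elim/(well_founded_ind (@wo_wf W)): v => v IH vw.
by split=> -[u uw] uv; exact: IH.
Qed.

Fact seg_trans x y z : seg_lt x y -> seg_lt y z -> seg_lt x z.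
Proof. exact: wo_trans. Qed.

Fact seg_total x y : [\/ seg_lt x y, x = y | seg_lt y x].
Proof.
have [xy|xy|yx] := wo_total (sval x) (sval y).
- by constructor 1.
- by constructor 2; case: x y xy => x xw [y yw] /=; exact: eq_exist.
- by constructor 3.
Qed.

Definition wo_seg : wo_ordinal := WoOrdinal seg_wf seg_trans seg_total.

End Segments.

Lemma wo_seg_lt (W : wo_ordinal) (v w : W) : wo_lt v w -> ord_lt (wo_seg v) (wo_seg w).
Proof.
move=> vw; exists (exist _ v vw).
exists (fun u : wo_seg v => exist _ (sval u) (wo_trans (svalP u) vw)).
split=> // -[u uw]; split=> [uv|[[x xv] <-] //].
by exists (exist _ u uv); apply: eq_exist.
Qed.

Lemma quot_proj_eq0 (A : comPzRingType) (U : set A) (y : A) :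
  quot_proj U y = 0 <-> gen_ideal U y.
Proof. by rewrite -[0](rmorph0 (quot_proj U)) quot_projP subr0. Qed.

Lemma sub_gen_ideal (A : comPzRingType) (U : set A) : U `<=` gen_ideal U.
Proof. by move=> y Uy I [_]; exact. Qed.

(** A quotient of [R] is again a quotient of [A], so the induction keeps [A] and varies only the
    surjection [phi]. *)
Lemma jac_rank_triple (W : wo_ordinal) (w : W) (A R : comPzRingType)
    (phi : {rmorphism A -> R}) (x x' : A) : (forall u, exists y, phi y = u) ->
  jac_rank w [set y | phi y = 0] x x' -> jacobson_triple (wo_seg w) (phi x) (phi x').
Proof.
elim/(well_founded_ind (@wo_wf W)): w R phi => w IH R phi surj G.
have [wpos|w0] := pselect (exists v, wo_lt v w); last first.
  apply: JacobsonZero; first by case=> v vw; apply: w0; exists v.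
  by have [n] := jac_rank0 w0 G; rewrite /= rmorphXn; exists n.
have [s Hs] := jac_rank_pos wpos G.
apply: JacobsonPos; first by case: wpos => v vw; apply; exists v.
exists (size s), (fun i => phi (tnth (in_tuple s) i)) => b U.
pose psi : {rmorphism A -> ring_quot U} := quot_proj U \o phi.
have [|y|a|v vw Gv] := Hs [set y | psi y = 0].
- exact: (kernel_ideal psi).
- by rewrite /= => ->; rewrite rmorph0.
- move=> /(tnthP (in_tuple s))[i ai]; have [b' b'E] := surj (b i); exists b'.
  apply/quot_proj_eq0; apply: sub_gen_ideal; exists i => //.
  by rewrite !(rmorphB, rmorphM, rmorph1) /= b'E -ai.
- exists (wo_seg v); split; first exact: wo_seg_lt.
  apply: (IH v vw _ psi) => // u; have [y yE] := surj (repr u).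
  by exists y; rewrite /= yE quot_proj_repr.
Qed.

(** The map [f] places [beta] as the segment of [W] below [w], so that all ranks live in [W].
    Inverses modulo [K] supply the [b] of the definition; [K] then contains the kernel of the map
    onto that quotient, and rank bounds pass to larger ideals. *)
Lemma triple_jac_rank (W : wo_ordinal) (beta : wo_ordinal) (w : W) (f : beta -> W)
    (A R : comPzRingType) (phi : {rmorphism A -> R}) (x x' : A) :
  (forall s t, wo_lt s t <-> wo_lt (f s) (f t)) ->
  (forall v, wo_lt v w <-> exists s, f s = v) ->
  (forall u, exists y, phi y = u) ->
  jacobson_triple beta (phi x) (phi x') -> jac_rank w [set y | phi y = 0] x x'.
Proof.
elim/(well_founded_ind ord_lt_wf): beta w f R phi => beta IH w f R phi fm fi surj.
case=> [_ [n xn]|_ [n [a Ha]]].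
  by apply: JacNil; exists n; rewrite /= rmorphXn.
have [a' a'E] := choice (fun i => surj (a i)).
apply: (JacStep (s := codom a')) => K idK kerK unitK.
have /choice[b bE] i : exists b, K (1 - b * (1 - a' i * x)).
  exact/unitK/codom_f.
have [gamma [[s [g [gm gi]]] Hg]] := Ha (fun i => phi (b i)).
pose U := range (fun i : 'I_n => 1 - phi (b i) * (1 - a i * phi x)).
pose psi : {rmorphism A -> ring_quot U} := quot_proj U \o phi.
have fs : wo_lt (f s) w by apply/fi; exists s.
exists (f s) => //; apply: (jac_rank_sub (I := [set y | psi y = 0])).
  move=> y /quot_proj_eq0 /(_ (phi @` K)) []; last first.
    move=> z Kz zy; rewrite -[y](subKr z); apply: idealB => //; apply: kerK.
    by rewrite /= rmorphB zy subrr.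
  split.
    split=> [|_ _ [y1 K1 <-] [y2 K2 <-]|c _ [y1 K1 <-]].
    - by exists 0; [exact: ideal0 | rewrite rmorph0].
    - by exists (y1 + y2); [exact: idealD | rewrite rmorphD].
    - by have [c' <-] := surj c; exists (c' * y1); [exact: idealMl | rewrite rmorphM].
  move=> _ [i _ <-]; exists (1 - b i * (1 - a' i * x)) => //.
  by rewrite !(rmorphB, rmorphM, rmorph1) /= a'E.
apply: (IH gamma _ (f s) (f \o g) _ psi) => //.
- by exists s, g.
- by move=> t1 t2; rewrite gm fm.
- move=> v; split=> [vfs|[t <-]]; last by apply/fm/gi; exists t.
  have /fi[t tv] : wo_lt v w by exact: wo_trans vfs fs.
  have /gi[t' t't] : wo_lt t s by apply/fm; rewrite tv.
  by exists t'; rewrite /= t't.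
- by move=> u; have [y yE] := surj (repr u); exists y; rewrite /= yE quot_proj_repr.
Qed.

Theorem corollary25 (alpha : wo_ordinal) (A : comPzRingType) :
  jacobson_ring alpha A -> jacobson_ring (ord_succ alpha) (pzpoly A).
Proof.
move=> HA f; apply: JacobsonPos; first by move/(_ None).
exists 1%N, (fun=> pzX A) => b U.
(* The segment below [None] is a copy of [alpha]. *)
exists (wo_seg (None : ord_succ alpha)); split.
  exists None, sval; split=> // z; split=> [zN|[[x xN] <-] //].
  by exists (exist _ z zN).
apply: jac_rank_triple => [u|]; first by exists (repr u); exact: quot_proj_repr.
apply: (@jac_rank_unit _ _ _ f (b ord0)) => [a||].
- have -> : [set 0] = [set y : A | (idfun : {rmorphism A -> A}) y = 0] by [].
  apply: (@triple_jac_rank (ord_succ alpha) alpha None Some A A idfun a a) => //.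
  + by case=> [v|]; split=> //; [exists v | case].
  + by move=> u; exists u.
- exact: (kernel_ideal (quot_proj U)).
- by apply/quot_proj_eq0; apply: sub_gen_ideal; exists ord0.
Qed.
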